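(* Let $W$ be a real vector space, let $I$ be a linear subspace of the space of linear functions $W\to\mathbb{R}$, and equip $W$ with the $\sigma$-field $\mathcal{B}=\sigma(f:f\in I)$. Let $E_n=(\Omega_n,\mathcal{A}_n,\{P_{n,\vartheta}:\vartheta\in\Theta\})$ be a sequence of statistical experiments, $g_n:\Theta\to W$ a sequence of statistical functionals, and $\vartheta_0\in\Theta$. For each $n$ let $\mathcal{K}_n$ be a class of estimators of $g_n$, unbiased at $\vartheta_0$, satisfying assumption (A), and let $S_n\in\mathcal{K}_n$ be a minimum variance estimator at $\vartheta_0$, i.e. $\mathrm{Var}_{\vartheta_0}(f(S_n))=\min_{T\in\mathcal{K}_n}\mathrm{Var}_{\vartheta_0}(f(T))$ for all $f\in I$. Let $T_n\in\mathcal{K}_n$ be a competing sequence of estimators such that, for all $f\in I$, $$a_n\big(f(S_n)-E_{\vartheta_0}(f(S_n)),\ f(T_n)-E_{\vartheta_0}(f(T_n))\big)\to(f(S),f(T))$$ is weakly convergent under $\vartheta_0$ to a centered Gaussian random variable $(f(S),f(T))$, where $a_n>0$ denotes a normalizing sequence. Assume that $S$ and $T$ are $W$-valued random variables. Let in addition $$\mathrm{Var}_{\vartheta_0}(a_nf(S_n))\to\mathrm{Var}(f(S))\quad\text{and}\quad\mathrm{Var}_{\vartheta_0}(a_nf(T_n))\to\mathrm{Var}(f(T))$$ hold for all $f\in I$ as $n\to\infty$. Then the convolution theorem holds for the asymptotic distributions on $W$: $$\mathcal{L}(T)=\mathcal{L}(S)\ast\mathcal{L}(T-S).$$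
   Context: Estimators are $(\mathcal{A}_n,\mathcal{B})$-measurable maps $\Omega_n\to W$. Expectations, variances and weak convergence ''under $\vartheta_0$'' refer to $P_{n,\vartheta_0}$. The random variables $S,T$ are defined on a common probability space; $\mathcal{L}$ denotes distribution and $\ast$ convolution on $(W,\mathcal{B})$. Assumption (A) for $\mathcal{K}_n$: every $T\in\mathcal{K}_n$ is an estimator $T:\Omega_n\to W$ with $E_{\vartheta_0}(f(T))=f(g_n(\vartheta_0))$ and $\mathrm{Var}_{\vartheta_0}(f(T))<\infty$ for all $f\in I$, and $\mathcal{K}_n$ has the extended convexity property $a\mathcal{K}_n+(1-a)\mathcal{K}_n\subset\mathcal{K}_n$ for all $a\in\mathbb{R}$. *)

(* Defs.v *)
From HB Require Import structures.
From mathcomp Require Export all_boot all_order all_algebra.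
From mathcomp Require Export all_classical all_reals all_analysis.
Export numFieldNormedType.Exports.
Export Order.TTheory GRing.Theory Num.Theory.

Set Implicit Arguments.
Unset Strict Implicit.
Unset Printing Implicit Defensive.

Local Open Scope classical_set_scope.
Local Open Scope ring_scope.

Section FunctionalSigmaField.
Context {R : realType} {W : lmodType R}.

(* The vector space structure on [W -> R^o] is the pointwise one. *)
Definition linear_functional_space (I : set (W -> R^o)) : Prop :=
  submod_closed [pred f | f \in I] /\ (forall f, I f -> scalar f).

Definition functional_preimages (I : set (W -> R^o)) : set (set W) :=
  [set A | exists2 f, I f & exists2 B : set R, measurable B & A = f @^-1` B].

(* The type [W], seen as a measurable space with sigma-field sigma(f : f in I). *)
Definition sigmaW (I : set (W -> R^o)) : Type := W.

HB.instance Definition _ I := Pointed.copy (sigmaW I) (W : zmodType).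
HB.instance Definition _ I := Measurable.copy (sigmaW I)
  (g_sigma_algebraType (functional_preimages I : set (set (sigmaW I)))).

(* [mu] and [nu] are meant to be probability measures on [sigmaW I]. Addition is
   measurable for the product sigma-field because the elements of [I] are linear. *)
Definition convolution (I : set (W -> R^o)) (mu nu : set (sigmaW I) -> \bar R)
    : set (sigmaW I) -> \bar R :=
  pushforward (mu \x nu)%E
    (fun z : sigmaW I * sigmaW I => ((z.1 : W) + (z.2 : W) : sigmaW I)).

End FunctionalSigmaField.

Section Estimators.
Context {R : realType} {W : lmodType R} (I : set (W -> R^o)).
Context {d : measure_display} {Omega : measurableType d} (P : probability Omega R).

Definition estimator (T : Omega -> W) : Prop :=
  measurable_fun [set: Omega] (T : Omega -> sigmaW I).

(* [expectation] is total, hence the explicit integrability. *)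
Definition unbiased_at (gamma : W) (T : Omega -> W) : Prop :=
  forall f, I f ->
    P.-integrable [set: Omega] (EFin \o (f \o T)) /\
    ('E_P[f \o T] = (f gamma)%:E)%E.

Definition finite_variance (T : Omega -> W) : Prop :=
  forall f, I f -> ('V_P[f \o T] < +oo)%E.

(* [gamma] is the value of the statistical functional at the true parameter. *)
Definition assumption_A (gamma : W) (K : set (Omega -> W)) : Prop :=
  (forall T, K T -> [/\ estimator T, unbiased_at gamma T & finite_variance T]) /\
  (forall (a : R) T1 T2, K T1 -> K T2 ->
     K (fun w => a *: T1 w + (1 - a) *: T2 w)).

Definition minimum_variance_estimator (K : set (Omega -> W)) (S : Omega -> W)
    : Prop :=
  K S /\ forall f, I f -> forall T, K T -> ('V_P[f \o S] <= 'V_P[f \o T])%E.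

End Estimators.

Section AsymptoticDistributions.
Context {R : realType}.

(* Weak convergence of the laws of [X n] under [P n] to the law of [Y] under [Q]. *)
Definition weakly_convergent {E : topologicalType}
    {d : nat -> measure_display} {Omega : forall n, measurableType (d n)}
    (P : forall n, probability (Omega n) R) (X : forall n, Omega n -> E)
    {d' : measure_display} {Omega' : measurableType d'}
    (Q : probability Omega' R) (Y : Omega' -> E) : Prop :=
  forall h : E -> R, continuous h -> (exists M : R, forall x, `|h x| <= M) ->
    'E_(P n)[h \o X n]%E @[n --> \oo] --> 'E_Q[h \o Y]%E.

Context {d : measure_display} {Omega : measurableType d} (Q : probability Omega R).

(* N(0, s^2), with N(0, 0) the Dirac mass at 0; [normal_prob 0 0] is instead
   a junk value. *)
Definition centered_normal (X : Omega -> R) : Prop :=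
  exists s : R, forall B : set R, measurable B ->
    pushforward Q X B = if s == 0 then \d_(0 : R) B else normal_prob 0 s B.

(* A random vector is Gaussian iff all its linear combinations are normal;
   degenerate covariance matrices are allowed. *)
Definition centered_gaussian_pair (X Y : Omega -> R) : Prop :=
  forall a b : R, centered_normal (fun w => a * X w + b * Y w).

End AsymptoticDistributions.

(* Main.v *)
From HB Require Import structures.
Require Import Defs.
From mathcomp Require Import measurable_realfun ring lra.

(** Both sides of the convolution identity are probability measures on W with
    the sigma-field generated by I, and such a measure is determined by the
    laws of the functionals f in I (a Cramer-Wold theorem,
    [convolution_of_projections]).  Since every f is linear, it is therefore
    enough to show, for one f at a time, that f(T) has the law of the sum of
    independent copies of f(S) and f(T - S).

    Fix f.  For every real b the estimator b T_n + (1 - b) S_n lies in K_n, so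
    that b = 0 minimizes the variance of its image by f; the derivative at
    b = 0 vanishes, which says Cov(f(S_n), f(T_n)) = Var(f(S_n))
    ([covariance_minimum_variance]).  To pass this relation to the limit it
    suffices to know that second moments are lower semicontinuous under weak
    convergence ([weakly_convergent_integral_le]): with X = f(S), Y = f(T) it
    gives E(X + Y)^2 <= 3 Var X + Var Y and E(X - Y)^2 <= Var Y - Var X.  The
    right-hand sides add up to 2 Var X + 2 Var Y, and so do the left-hand
    sides, by the parallelogram identity; hence both inequalities are
    equalities.  In particular Var(f(T)) = Var(f(S)) + Var(f(T - S)).  The
    three variables are centered normal, and convolving centered normal laws
    adds their variances ([normal_prob_convolution]); this is the required
    identity for f ([gaussian_pair_convolution]).

    Covariances between different functionals need not vanish: for f and h in
    I the form Cov(f(S), h(T - S)) is only antisymmetric.  So S and T - S need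
    not be independent as W-valued variables; the argument only uses the laws
    of f(S), f(T - S) and f(T) with the same f. *)

Set Implicit Arguments.
Unset Strict Implicit.
Unset Printing Implicit Defensive.

Local Open Scope classical_set_scope.
Local Open Scope ring_scope.

(** * Bounded measurable functions *)

Section BoundedMeasurable.
Context {R : realType} {d : measure_display} {T : measurableType d}.
Implicit Types h k : T -> R.

Definition bounded_measurable h : Prop :=
  measurable_fun [set: T] h /\ exists M : R, forall x, `|h x| <= M.

Lemma bounded_measurable_cst (c : R) : bounded_measurable (fun=> c).
Proof. by split; [exact: measurable_cst | exists `|c|]. Qed.

Lemma bounded_measurableD h k : bounded_measurable h -> bounded_measurable k ->
  bounded_measurable (fun x => h x + k x).
Proof.
move=> [mh [M hM]] [mk [N kN]]; split; first exact: measurable_funD.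
by exists (M + N) => x; rewrite (le_trans (ler_normD _ _)) ?lerD.
Qed.

Lemma bounded_measurableM h k : bounded_measurable h -> bounded_measurable k ->
  bounded_measurable (fun x => h x * k x).
Proof.
move=> [mh [M hM]] [mk [N kN]]; split; first exact: measurable_funM.
by exists (M * N) => x; rewrite normrM ler_pM.
Qed.

Lemma bounded_measurable_cos h (c : R) : measurable_fun [set: T] h ->
  bounded_measurable (fun x => cos (h x + c)).
Proof.
move=> mh; split; last by exists 1 => x; exact: cos_max.
apply: (measurableT_comp (continuous_measurable_fun (@continuous_cos R))).
exact: measurable_funD.
Qed.

Lemma bounded_measurable_integrable (mu : {finite_measure set T -> \bar R}) h :
  bounded_measurable h -> mu.-integrable [set: T] (EFin \o h).
Proof.
move=> [mh [M hM]]; apply: measurable_bounded_integrable => //.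
  by rewrite ltey_eq fin_num_measure.
exists `|M|; split; first exact: num_real.
move=> N MN x _; apply: (le_trans (hM x)); apply: ltW.
exact: le_lt_trans (ler_norm M) MN.
Qed.

Lemma Rintegral_bounded_cvg (mu : {finite_measure set T -> \bar R})
    (u : nat -> T -> R) h (M : R) :
  (forall n, measurable_fun [set: T] (u n)) ->
  (forall n x, `|u n x| <= M) -> (forall x, u n x @[n --> \oo] --> h x) ->
  (\int[mu]_x u n x) @[n --> \oo] --> \int[mu]_x h x.
Proof.
move=> mu_ uM uh.
have mh : measurable_fun [set: T] h.
  by apply: (measurable_fun_cvg mu_) => x _; exact: uh.
have [] := @dominated_convergence _ T R mu [set: T] measurableT
  (fun n => EFin \o u n) (EFin \o h) (cst M%:E).
- by move=> n; exact/measurable_EFinP.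
- exact/measurable_EFinP.
- by apply: aeW => x _; apply: cvg_EFin; [exact: nearW | exact: uh].
- by apply: (bounded_measurable_integrable mu); exact: bounded_measurable_cst.
- by apply: aeW => x n _; rewrite lee_fin.
move=> ih _ cvgI.
apply: fine_cvg; rewrite fineK ?integrable_fin_num//.
Qed.

End BoundedMeasurable.

(** * Polynomials converging to a step function *)

Section ThresholdPolynomial.
Context {R : realType}.

Lemma cvg_natM_expr (r : R) : 0 <= r < 1 -> n%:R * r ^+ n @[n --> \oo] --> (0 : R).
Proof.
move=> /andP[r0 r1].
have [->|rn0] := eqVneq r 0.
  apply: cvg_near_cst; near=> n; rewrite expr0n.
  rewrite (_ : (n == 0)%N = false) ?mulr0//.
  by apply/negbTE; rewrite -lt0n; near: n; exact: nbhs_infty_gt.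
have rgt0 : 0 < r by rewrite lt_neqAle eq_sym rn0.
(* writing r = s^2, one factor s^n absorbs n and the other one tends to 0 *)
pose s := Num.sqrt r.
have s0 : 0 < s by rewrite sqrtr_gt0.
have s1 : s < 1 by rewrite -sqrtr1 ltr_sqrt.
have sE : s ^+ 2 = r by rewrite sqr_sqrtr.
pose k := s^-1 - 1.
have k0 : 0 < k by rewrite subr_gt0 invf_gt1.
(* Bernoulli's inequality for s^-1 = 1 + k *)
have bern n : n%:R * s ^+ n <= k^-1.
  have : 1 + k *+ n <= (s^-1) ^+ n.
    have -> : s^-1 = 1 + k by rewrite /k addrC subrK.
    elim: n => [|n IH]; first by rewrite mulr0n addr0 expr0.
    rewrite exprS mulrS; apply: le_trans (ler_wpM2l _ IH); last first.
      by rewrite addr_ge0// ltW.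
    rewrite mulrDl mul1r mulrDr mulr1.
    have : 0 <= k * (k *+ n) by rewrite mulr_ge0 ?mulrn_wge0 ?ltW.
    lra.
  move=> H.
  rewrite -ler_pdivlMr ?exprn_gt0// -exprVn -(ler_pM2l k0) mulrA.
  rewrite divff ?gt_eqF// mul1r.
  by apply: le_trans H; rewrite mulr_natr lerDr.
apply: (@squeeze_cvgr _ _ _ _ (cst 0) (fun n => k^-1 * s ^+ n)).
- near=> n; apply/andP; split; first by rewrite mulr_ge0// exprn_ge0.
  rewrite -sE -exprM mulnC exprM expr2 mulrA.
  by rewrite ler_wpM2r// exprn_ge0// ltW.
- exact: cvg_cst.
- rewrite -[X in _ --> X](mulr0 k^-1); apply: cvgM; first exact: cvg_cst.
  by apply: cvg_expr; rewrite ger0_norm// ltW.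
Unshelve. all: by end_near. Qed.

(** On [0, 1] these polynomials converge to the indicator of x < 1/2.  The
    exponent n 2^n, instead of the usual 2^n, forces the limit 0 also at the
    threshold x = 1/2. *)
Definition threshold_poly (n : nat) (x : R) : R := (1 - x ^+ n) ^+ (n * 2 ^ n).

Lemma threshold_poly_itv n (x : R) : 0 <= x <= 1 -> 0 <= threshold_poly n x <= 1.
Proof.
move=> /andP[x0 x1].
have xn1 : x ^+ n <= 1 by rewrite exprn_ile1.
have xn0 : 0 <= x ^+ n by rewrite exprn_ge0.
by rewrite exprn_ge0 ?exprn_ile1//; lra.
Qed.

Lemma bernoulli_lower (z : R) N : 0 <= z <= 1 -> 1 - N%:R * z <= (1 - z) ^+ N.
Proof.
move=> /andP[z0 z1]; elim: N => [|N IH]; first by rewrite mul0r subr0 expr0.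
rewrite exprS -natr1; apply: le_trans (ler_wpM2l _ IH); last by lra.
have : 0 <= N%:R * z * z by rewrite !mulr_ge0.
nra.
Qed.

Lemma bernoulli_upper (z : R) N : 0 <= z <= 1 ->
  (1 - z) ^+ N * (1 + N%:R * z) <= 1.
Proof.
move=> /andP[z0 z1].
have H : 1 + N%:R * z <= (1 + z) ^+ N.
  elim: N => [|N IH]; first by rewrite mul0r addr0 expr0.
  rewrite exprS -natr1; apply: le_trans (ler_wpM2l _ IH); last by lra.
  have : 0 <= N%:R * z * z by rewrite !mulr_ge0.
  nra.
apply: (@le_trans _ _ ((1 - z) ^+ N * (1 + z) ^+ N)).
  by rewrite ler_wpM2l// exprn_ge0//; lra.
by rewrite -exprMn exprn_ile1//; nra.
Qed.

(** With z = x^n and N = n 2^n one has N z = n (2x)^n.  This tends to 0 when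
    x < 1/2 and is at least n otherwise, so the two Bernoulli bounds
    1 - N z <= (1 - z)^N <= 1 / (1 + N z) decide the limit. *)
Lemma threshold_poly_cvg (x : R) : 0 <= x <= 1 ->
  threshold_poly n x @[n --> \oo] --> ((x < 1 / 2)%R%:R : R).
Proof.
move=> x01; have /andP[x0 x1] := x01.
have z01 n : 0 <= x ^+ n <= 1 by rewrite exprn_ge0 ?exprn_ile1.
have NE n : (n * 2 ^ n)%:R * x ^+ n = n%:R * (2 * x) ^+ n.
  by rewrite natrM natrX -mulrA -exprMn.
have [xl|xg] := ltrP x (1 / 2).
  apply: (@squeeze_cvgr _ _ _ _ (fun n => 1 - n%:R * (2 * x) ^+ n) (cst 1)).
  - near=> n; rewrite -NE bernoulli_lower//=.
    by have /andP[] := threshold_poly_itv n x01.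
  - rewrite -[X in _ --> X]subr0; apply: cvgB; first exact: cvg_cst.
    by apply: cvg_natM_expr; lra.
  - exact: cvg_cst.
apply: (@squeeze_cvgr _ _ _ _ (cst 0) (fun n => (1 + n%:R)^-1)).
- near=> n; apply/andP; split.
    by have /andP[] := threshold_poly_itv n x01.
  rewrite -[leRHS]mul1r ler_pdivlMr ?ltr_pwDl//.
  apply: le_trans (bernoulli_upper (n * 2 ^ n) (z01 n)).
  rewrite ler_wpM2l//; first by have /andP[] := threshold_poly_itv n x01.
  rewrite lerD2l NE ler_peMr// exprn_ege1//; lra.
- exact: cvg_cst.
- have := @cvg_harmonic R; rewrite /harmonic/=.
  by under eq_fun do rewrite -natr1 addrC.
Unshelve. all: by end_near. Qed.

End ThresholdPolynomial.

(** * Measures determined by their trigonometric integrals *)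

Section TrigonometricUniqueness.
Context {R : realType} {d : measure_display} {T : measurableType d}.
Variables (mu nu : {finite_measure set T -> \bar R}) (Phi : set (T -> R)).
Hypothesis mPhi : forall f, Phi f -> measurable_fun [set: T] f.
Hypothesis PhiD : forall f g, Phi f -> Phi g -> Phi (fun x => f x + g x).
Hypothesis PhiZ : forall (r : R) f, Phi f -> Phi (fun x => r * f x).
Implicit Types h k : T -> R.

(** The test functions that still cannot tell mu from nu after multiplication
    by a cosine.  Putting the cosine into the definition makes the class stable
    under multiplication by cosines, hence by polynomials in them. *)
Definition trig_indistinguishable h : Prop :=
  bounded_measurable h /\ forall f c, Phi f ->
    \int[mu]_x (h x * cos (f x + c)) = \int[nu]_x (h x * cos (f x + c)).

Let bm_cos h f c : bounded_measurable h -> Phi f ->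
  bounded_measurable (fun x => h x * cos (f x + c)).
Proof.
move=> bh /mPhi mf.
by apply: bounded_measurableM => //; exact: bounded_measurable_cos.
Qed.

Lemma trig_indistinguishable_lin (r s : R) h k :
  trig_indistinguishable h -> trig_indistinguishable k ->
  trig_indistinguishable (fun x => r * h x + s * k x).
Proof.
move=> [bh hE] [bk kE].
have bZ (t : R) g : bounded_measurable g ->
    bounded_measurable (fun x : T => t * g x).
  by move=> bg; apply: bounded_measurableM => //; exact: bounded_measurable_cst.
split; first by apply: bounded_measurableD; exact: bZ.
move=> f c Pf; under eq_Rintegral do rewrite mulrDl -!mulrA.
under [RHS]eq_Rintegral do rewrite mulrDl -!mulrA.
have bhf := bm_cos c bh Pf; have bkf := bm_cos c bk Pf.
have bI (rho : {finite_measure set T -> \bar R}) g :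
  bounded_measurable g -> rho.-integrable [set: T] (EFin \o g).
  exact: bounded_measurable_integrable.
rewrite !RintegralD//; try by apply: bI; exact: bZ.
by rewrite !RintegralZl//; try exact: bI; rewrite hE// kE.
Qed.

(** A product of two cosines is the mean of two cosines, whose phases still
    belong to the linear space Phi. *)
Lemma trig_indistinguishable_cos h f c : Phi f ->
  trig_indistinguishable h -> trig_indistinguishable (fun x => h x * cos (f x + c)).
Proof.
move=> Pf [bh hE]; split; first exact: bm_cos.
move=> g b Pg.
have Pp := PhiD Pf Pg; have Pm := PhiD Pf (PhiZ (-1) Pg).
have bI (rho : {finite_measure set T -> \bar R}) u :
  bounded_measurable u -> rho.-integrable [set: T] (EFin \o u).
  exact: bounded_measurable_integrable.
have E (rho : {finite_measure set T -> \bar R}) :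
  \int[rho]_x (h x * cos (f x + c) * cos (g x + b)) =
  2^-1 * (\int[rho]_x (h x * cos ((f x + g x) + (c + b))) +
         \int[rho]_x (h x * cos ((f x + -1 * g x) + (c - b)))).
  have bp := bm_cos (c + b) bh Pp; have bm := bm_cos (c - b) bh Pm.
  rewrite -RintegralD//; try exact: bI.
  rewrite -RintegralZl//; last by apply: bI; exact: bounded_measurableD.
  apply: eq_Rintegral => x _.
  have -> : f x + g x + (c + b) = (f x + c) + (g x + b) by ring.
  have -> : f x + -1 * g x + (c - b) = (f x + c) - (g x + b) by ring.
  by rewrite cosB (cosD (f x + c)); field.
by rewrite !E !hE.
Qed.

Lemma trig_indistinguishable_lim (u : nat -> T -> R) h (M : R) :
  (forall n, trig_indistinguishable (u n)) -> (forall n x, `|u n x| <= M) ->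
  (forall x, u n x @[n --> \oo] --> h x) -> trig_indistinguishable h.
Proof.
move=> uG uM uh; split.
  split; first by apply: (measurable_fun_cvg (fun n => (uG n).1.1)) => x _; exact: uh.
  exists M => x.
  have nuh : `|u n x| @[n --> \oo] --> `|h x| by apply: cvg_norm; exact: uh.
  rewrite -(cvg_lim _ nuh)//; apply: limr_le; first by apply/cvg_ex; exists `|h x|.
  by apply: nearW => n; exact: uM.
move=> f c Pf.
have H (rho : {finite_measure set T -> \bar R}) :
    (\int[rho]_x (u n x * cos (f x + c))) @[n --> \oo] -->
    \int[rho]_x (h x * cos (f x + c)).
  apply: (@Rintegral_bounded_cvg _ _ _ rho _ _ M).
  - by move=> n; have [] := bm_cos c (uG n).1 Pf.
  - move=> n x; rewrite normrM -[leRHS]mulr1 ler_pM//; exact: cos_max.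
  - by move=> x; apply: cvgM; [exact: uh|exact: cvg_cst].
apply: (cvg_unique _ (H mu)) => //.
rewrite [X in X @ _](_ : _ = 
  (fun n => \int[nu]_x (u n x * cos (f x + c)))); first exact: H.
by apply/funext => n; exact: (uG n).2.
Qed.

(** Sets defined by a stability property rather than by mu A = nu A: unlike
    the latter condition it passes to intersections, so that these sets form a
    sigma-algebra. *)
Definition trig_multiplier (A : set T) : Prop :=
  measurable A /\ forall h, trig_indistinguishable h ->
    trig_indistinguishable (fun x => h x * \1_A x).

Let trig_bound h : trig_indistinguishable h -> exists M, forall x, `|h x| <= M.
Proof. by case=> -[]. Qed.

Let trig_lin1 (r s : R) h k l : trig_indistinguishable h -> trig_indistinguishable k ->
  (forall x, l x = r * h x + s * k x) -> trig_indistinguishable l.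
Proof. by move=> H K /funext ->; exact: trig_indistinguishable_lin. Qed.

Lemma trig_multiplier_lim (A : nat -> set T) (B : set T) :
  (forall n, trig_multiplier (A n)) ->
  (forall x, \forall n \near \oo, (x \in A n) = (x \in B)) -> trig_multiplier B.
Proof.
move=> mulA AB.
have cvgI x : (\1_(A n) x : R) @[n --> \oo] --> (\1_B x : R).
  by apply: cvg_near_cst; apply: filterS (AB x) => n E; rewrite !indicE E.
split.
  have mB : measurable_fun [set: T] (\1_B : T -> R).
    apply: (@measurable_fun_cvg _ _ _ _ (fun n => \1_(A n))) => [n|x _];
      last exact: cvgI.
    exact/measurable_indic/(mulA n).1.
  have := mB measurableT [set 1] (measurable_set1 1); rewrite setTI.
  congr (measurable _); apply/seteqP; split=> x /=; rewrite indicE.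
    by case: (boolP (x \in B)) => [/set_mem//|_ /eqP]; rewrite eq_sym oner_eq0.
  by move=> /mem_set ->.
move=> h hG; have [M hM] := trig_bound hG.
apply: (@trig_indistinguishable_lim (fun n x => h x * \1_(A n) x) _ M).
- by move=> n; exact: (mulA n).2.
- move=> n x; rewrite indicE; case: (_ \in _); rewrite ?mulr1//.
  by rewrite mulr0 normr0 (le_trans _ (hM x)).
- by move=> x; apply: cvgM; [exact: cvg_cst|exact: cvgI].
Qed.

Lemma trig_multiplierC A : trig_multiplier A -> trig_multiplier (~` A).
Proof.
move=> [mA H]; split; first exact: measurableC.
move=> h hG; apply: (trig_lin1 (r := 1) (s := -1) hG (H _ hG)) => x.
by rewrite !indicE in_setC; case: (x \in A); rewrite /= ?mulr1n ?mulr0n; ring.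
Qed.

Lemma trig_multiplierU A B : trig_multiplier A -> trig_multiplier B ->
  trig_multiplier (A `|` B).
Proof.
move=> mA mB; rewrite -(setCK (A `|` B)) setCU; apply: trig_multiplierC.
have [mA' {}mA] := trig_multiplierC mA; have [mB' {}mB] := trig_multiplierC mB.
split; first exact: measurableI.
move=> h hG.
rewrite [X in trig_indistinguishable X](_ : _ =
  (fun x => h x * \1_(~` A) x * \1_(~` B) x)).
  exact/mB/mA.
by apply/funext => x; rewrite indicI/= mulrA.
Qed.

Lemma trig_multiplier_bigcup (A : nat -> set T) :
  (forall n, trig_multiplier (A n)) -> trig_multiplier (\bigcup_n A n).
Proof.
move=> mulA.
apply: (@trig_multiplier_lim (fun n => \big[setU/set0]_(i < n) A i)).
  move=> n; elim/big_ind : _ => //; last exact: trig_multiplierU.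
  split=> // h hG; apply: (trig_lin1 (r := 0) (s := 0) hG hG) => x.
  by rewrite indicE in_set0 mulr0 !mul0r addr0.
move=> x; have [xA|xA] := boolP (x \in \bigcup_n A n).
  have [i _ Ai] := set_mem xA; near=> n; apply/mem_set.
  rewrite -bigcup_mkord; exists i => //=; near: n; exact: nbhs_infty_gt.
near=> n; apply/negbTE; apply: contra xA => /set_mem; rewrite -bigcup_mkord.
by move=> [i _ Ai]; apply/mem_set; exists i.
Unshelve. all: by end_near. Qed.

(** The indicator of cos < 0 is the bounded limit of the threshold polynomials
    in v = (1 + cos) / 2, which takes its values in [0, 1]. *)
Lemma trig_multiplier_cos_lt0 f c : Phi f ->
  trig_multiplier [set x | cos (f x + c) < 0].
Proof.
move=> Pf; have mcos := (bounded_measurable_cos c (mPhi Pf)).1; split.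
  rewrite (_ : mkset _ = (fun x => cos (f x + c)) @^-1` `]-oo, 0[); last first.
    by apply/seteqP; split=> x /=; rewrite in_itv.
  by rewrite -[X in measurable X]setTI; exact: mcos.
move=> h hG; have [M hM] := trig_bound hG.
pose v x := (1 + cos (f x + c)) / 2.
have v01 x : 0 <= v x <= 1.
  by rewrite /v; have := cos_geN1 (f x + c); have := cos_le1 (f x + c); lra.
have mulv k : trig_indistinguishable k ->
    trig_indistinguishable (fun x => k x * v x).
  move=> kG; apply: (trig_lin1 (r := 2^-1) (s := 2^-1) kG).
    exact: trig_indistinguishable_cos c Pf kG.
  by move=> x; rewrite /v; field.
have mulvn n k : trig_indistinguishable k ->
    trig_indistinguishable (fun x => k x * v x ^+ n).
  elim: n k => [|n IH] k kG.
    by apply: (trig_lin1 (r := 1) (s := 0) kG kG) => x; rewrite expr0; ring.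
  rewrite [X in trig_indistinguishable X](_ : _ =
      (fun x => k x * v x * v x ^+ n)).
    exact/IH/mulv.
  by apply/funext => x; rewrite exprS mulrA.
have mulp n N k : trig_indistinguishable k ->
    trig_indistinguishable (fun x => k x * (1 - v x ^+ n) ^+ N).
  elim: N k => [|N IH] k kG.
    by apply: (trig_lin1 (r := 1) (s := 0) kG kG) => x; rewrite expr0; ring.
  rewrite [X in trig_indistinguishable X](_ : _ =
      (fun x => (k x * (1 - v x ^+ n)) * (1 - v x ^+ n) ^+ N)).
    apply: IH; apply: (trig_lin1 (r := 1) (s := -1) kG (mulvn n _ kG)) => x; ring.
  by apply/funext => x; rewrite exprS mulrA.
apply: (@trig_indistinguishable_lim (fun n x => h x * threshold_poly n (v x)) _ M).
- by move=> n; exact: mulp.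
- move=> n x; have /andP[p0 p1] := threshold_poly_itv n (v01 x).
  by rewrite normrM (ger0_norm p0) (le_trans _ (hM x))// ler_piMr.
- move=> x; apply: cvgM; first exact: cvg_cst.
  rewrite indicE (_ : (x \in _) = (v x < 1 / 2)); first exact: threshold_poly_cvg.
  rewrite /v; apply/idP/idP => [/set_mem/= H|H]; last apply/mem_set => /=; lra.
Qed.

(** Rescaling removes the periodicity: for n large (f - a) / n lies between
    -pi and pi, where the sine has the sign of its argument, so that f > a is
    the pointwise limit of the events sin ((f - a) / n) > 0. *)
Lemma trig_multiplier_ray f (a : R) : Phi f -> trig_multiplier (f @^-1` `]a, +oo[).
Proof.
move=> Pf.
(* cos (y + pi / 2) = - sin y *)
pose A n : set T := [set x | cos (n.+1%:R^-1 * f x + (pi / 2 - n.+1%:R^-1 * a)) < 0].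
apply: (@trig_multiplier_lim A).
  by move=> n; apply: trig_multiplier_cos_lt0; exact: PhiZ.
move=> x.
have AE n : (x \in A n) = (0 < sin ((f x - a) / n.+1%:R)).
  have E : n.+1%:R^-1 * f x + (pi / 2 - n.+1%:R^-1 * a) = (f x - a) / n.+1%:R + pi / 2.
    by rewrite mulrC mulrBl (mulrC _ a) addrA addrAC.
  rewrite -oppr_lt0 -cosDpihalf -E.
  by apply/idP/idP => [/set_mem//|H]; exact/mem_set.
have BE : (x \in f @^-1` `]a, +oo[) = (0 < f x - a).
  rewrite subr_gt0; apply/idP/idP => [/set_mem|H]; last apply/mem_set.
    by rewrite /= in_itv/= andbT.
  by rewrite /= in_itv/= andbT.
pose y := f x - a.
have small : \forall n \near \oo, `|y / n.+1%:R| < pi.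
  near=> n; rewrite normrM normfV (ger0_norm (ler0n _ _)) ltr_pdivrMr//.
  rewrite mulrC -ltr_pdivrMr ?pi_gt0//.
  by rewrite -natr1 (lt_trans (y := n%:R)) ?ltrDl//; near: n; exact: nbhs_infty_gtr.
near=> n; rewrite AE BE -/y.
have np : `|y / n.+1%:R| < pi by near: n.
have [y0|y0|y0] := ltrgtP 0 y.
- apply/idP; apply: sin_gt0_pi; rewrite divr_gt0//=; exact: le_lt_trans (ler_norm _) np.
- apply/negbTE; rewrite -leNgt -oppr_ge0 -sinN -mulNr ltW//; apply: sin_gt0_pi.
  rewrite divr_gt0 ?oppr_gt0//=.
  by apply: le_lt_trans (ler_norm _) _; rewrite mulNr normrN.
- by rewrite -y0 mul0r sin0 ltxx.
Unshelve. all: by end_near. Qed.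

Lemma trig_multiplier_preimage f (B : set R) : Phi f -> measurable B ->
  trig_multiplier (f @^-1` B).
Proof.
move=> Pf.
suff : <<s @RGenOInfty.G R >> `<=` [set B | trig_multiplier (f @^-1` B)].
  have E : (measurable : set (set R)) = <<s @RGenOInfty.G R >> :=
    RGenOInfty.measurableE R.
  by move=> H mB; apply: H; rewrite -E.
apply: smallest_sub; last by move=> _ [a ->]; exact: trig_multiplier_ray.
split => /=.
- rewrite preimage_set0.
  have := trig_multiplier_ray 0 Pf => H.
  split=> // h hG; apply: (trig_lin1 (r := 0) (s := 0) hG hG) => x.
  by rewrite indicE in_set0 mulr0 !mul0r addr0.
- by move=> A HA; rewrite setTD preimage_setC; exact: trig_multiplierC.
- by move=> A HA; rewrite preimage_bigcup; exact: trig_multiplier_bigcup.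
Qed.

(** Two finite measures with the same integrals of all cos (f + c), where f
    ranges over a linear space of functions, agree on the sigma-field generated
    by these functions.  This is the uniqueness theorem for characteristic
    functions, in any number of dimensions. *)
Lemma eq_measure_trig (f0 : T -> R) : Phi f0 ->
  (forall f c, Phi f -> \int[mu]_x cos (f x + c) = \int[nu]_x cos (f x + c)) ->
  forall A, <<s [set A | exists2 f, Phi f &
                   exists2 B : set R, measurable B & A = f @^-1` B] >> A ->
    mu A = nu A.
Proof.
move=> Pf0 cosE A sA.
have [mA H] : trig_multiplier A.
  move: A sA; apply: smallest_sub; last first.
    by move=> _ [f Pf [B mB ->]]; exact: trig_multiplier_preimage.
  split.
  - by have := trig_multiplier_preimage Pf0 measurable0; rewrite preimage_set0.
  - by move=> A HA; rewrite setTD; exact: trig_multiplierC.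
  - by move=> A HA; exact: trig_multiplier_bigcup.
have oneG : trig_indistinguishable (fun=> 1).
  split; first exact: bounded_measurable_cst.
  move=> f c Pf; under eq_Rintegral do rewrite mul1r.
  by under [RHS]eq_Rintegral do rewrite mul1r; exact: cosE.
have [_ /(_ _ 0 (PhiZ 0 Pf0))] := H _ oneG.
have E (rho : {finite_measure set T -> \bar R}) :
    \int[rho]_x (1 * \1_A x * cos (0 * f0 x + 0)) = fine (rho A).
  under eq_Rintegral do rewrite mul0r add0r cos0 mul1r mulr1.
  by rewrite /Rintegral integral_indic// setIT.
rewrite !E => Efin.
by rewrite -[LHS]fineK ?fin_num_measure// Efin fineK ?fin_num_measure.
Qed.

End TrigonometricUniqueness.

(** * Normal laws *)

Section NormalLaw.
Context {R : realType}.
Implicit Types (m s u t k : R) (G : R -> R).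
Local Notation leb := (@lebesgue_measure R).

Lemma ge0_integral_normal_prob m s (f : R -> \bar R) :
  measurable_fun [set: R] f -> (forall x, (0 <= f x)%E) ->
  (\int[normal_prob m s]_x f x = \int[leb]_x (f x * (normal_pdf m s x)%:E))%E.
Proof.
move=> mf f0.
have dom := normal_prob_dominates m s.
have mpdf : measurable_fun [set: R] (fun x => (normal_pdf m s x)%:E).
  by apply/measurable_EFinP; exact: measurable_normal_pdf.
rewrite -(Radon_Nikodym_SigmaFinite.change_of_variables dom)//.
apply: ae_eq_integral => //.
- apply: emeasurable_funM => //.
  exact: measurable_int (Radon_Nikodym_SigmaFinite.f_integrable dom).
- exact: emeasurable_funM.
- apply: ae_eqe_mul2l; apply: integral_ae_eq => //.
    exact: Radon_Nikodym_SigmaFinite.f_integrable.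
  by move=> A _ mA; rewrite -Radon_Nikodym_SigmaFinite.f_integral.
Qed.

Lemma ge0_integral_affine m k G : 0 < k -> continuous G -> (forall x, 0 <= G x) ->
  (\int[leb]_x (G x)%:E = \int[leb]_x (G ((x - m) * k) * k)%:E)%E.
Proof.
move=> k0 cG G0.
pose F (x : R^o) : R^o := (x - m) * k.
have F'E : F^`()%classic = cst k.
  apply/funext => x; rewrite /F derive1E deriveM// deriveD// derive_cst scaler0.
  by rewrite add0r derive_id derive_cst addr0 scaler1.
rewrite (@increasing_ge0_integration_by_substitutionT _ F)//.
- by apply: eq_integral => x _; rewrite F'E.
- by move=> x y xy; rewrite /F ltr_pM2r// ltrD2r.
- by rewrite F'E => ?; exact: cvg_cst.
- by rewrite F'E; exact: is_cvg_cst.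
- by rewrite F'E; exact: is_cvg_cst.
- by apply/gt0_cvgMlNy => //; exact: cvg_addrr_Ny.
- by apply/gt0_cvgMly => //; exact: cvg_addrr.
Qed.

(** Completing the square in x. *)
Lemma normal_pdf_factor s u t x y : s != 0 -> u != 0 -> t ^+ 2 = s ^+ 2 + u ^+ 2 ->
  normal_pdf 0 s x * normal_pdf 0 u (y - x) =
  normal_pdf 0 t y * normal_pdf (s ^+ 2 / t ^+ 2 * y) (s * u / t) x.
Proof.
move=> s0 u0 tE.
have s20 : 0 < s ^+ 2 by rewrite exprn_even_gt0.
have u20 : 0 < u ^+ 2 by rewrite exprn_even_gt0.
have t20 : 0 < t ^+ 2 by rewrite tE addr_gt0.
have t0 : t != 0 by apply: contraTneq t20 => ->; rewrite expr0n ltxx.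
have su0 : s * u / t != 0 by rewrite !mulf_neq0// invr_neq0.
rewrite !normal_pdfE// mulrACA [RHS]mulrACA; congr (_ * _).
  rewrite /normal_peak -!invfM; congr (_^-1).
  have pp := @pi_ge0 R.
  have nn (z : R) : 0 <= z ^+ 2 * pi *+ 2 by rewrite mulrn_wge0 // mulr_ge0 // sqr_ge0.
  rewrite -(sqrtrM _ (nn s)) -(sqrtrM _ (nn t)). congr Num.sqrt.
  by rewrite !mulr2n; field.
rewrite /normal_fun -!expRD; congr expR.
rewrite !subr0 !mulr2n.
have uE : u ^+ 2 = t ^+ 2 - s ^+ 2 by rewrite tE; ring.
rewrite uE.
have -> : (s * u / t) ^+ 2 = s ^+ 2 * (t ^+ 2 - s ^+ 2) / t ^+ 2.
  by rewrite -uE; field.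
have su2 : 0 < s ^+ 2 * u ^+ 2 by exact: mulr_gt0.
have dbl (z : R) : 0 < z -> z + z != 0 by move=> z0; rewrite gt_eqF// addr_gt0.
by field; rewrite -uE t0 !dbl.
Qed.

(** By [normal_pdf_factor] and Tonelli's theorem the inner integral in x is
    that of a normal density, hence equal to 1. *)
Lemma normal_prob_convolution s u t G : s != 0 -> u != 0 ->
  t ^+ 2 = s ^+ 2 + u ^+ 2 -> continuous G -> (forall x, 0 <= G x) ->
  (\int[normal_prob 0 s]_x \int[normal_prob 0 u]_y (G (x + y))%:E =
   \int[normal_prob 0 t]_z (G z)%:E)%E.
Proof.
move=> s0 u0 tE cG G0.
have mG : measurable_fun [set: R] G by exact: continuous_measurable_fun.
have mpdf m v := measurable_normal_pdf m v.
pose f (z : R * R) := (G z.2 * normal_pdf 0 u (z.2 - z.1) * normal_pdf 0 s z.1)%:E.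
have f0 z : (0 <= f z)%E by rewrite lee_fin !mulr_ge0 ?normal_pdf_ge0.
have mf : measurable_fun [set: R * R] f.
  apply/measurable_EFinP; apply: measurable_funM; first apply: measurable_funM.
  - exact: measurableT_comp.
  - by apply: measurableT_comp => //; exact: measurable_funB.
  - exact: measurableT_comp.
have inner x : (\int[normal_prob 0 u]_y (G (x + y))%:E =
    \int[leb]_y (G y * normal_pdf 0 u (y - x))%:E)%E.
  rewrite ge0_integral_normal_prob.
  - rewrite (@ge0_integral_affine x 1 (fun z => G (x + z) * normal_pdf 0 u z))//.
    + by apply: eq_integral => y _; rewrite !mulr1 (addrC x) subrK.
    + move=> z; apply: cvgM; last exact: continuous_normal_pdf.
      apply: (continuous_comp (f := fun z => x + z)); last exact: cG.
      exact: cvgD (cvg_cst _) cvg_id.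
    + by move=> z; rewrite mulr_ge0 ?normal_pdf_ge0.
  - apply/measurable_EFinP; apply: measurableT_comp => //; exact: measurable_funD.
  - by move=> y; rewrite lee_fin.
under eq_integral do rewrite inner.
pose h (z : R * R) := (G z.2 * normal_pdf 0 u (z.2 - z.1))%:E.
have h0 z : (0 <= h z)%E by rewrite lee_fin mulr_ge0 ?normal_pdf_ge0.
have mh : measurable_fun [set: R * R] h.
  apply/measurable_EFinP; apply: measurable_funM.
  - exact: measurableT_comp.
  - by apply: measurableT_comp => //; exact: measurable_funB.
have mH : measurable_fun [set: R] (fun x => \int[leb]_y h (x, y))%E.
  exact: (measurable_fun_fubini_tonelli_F (m2 := leb) h mh h0).
rewrite (ge0_integral_normal_prob _ _ mH); last first.
  by move=> x; apply: integral_ge0.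
transitivity (\int[leb]_x \int[leb]_y f (x, y))%E.
  apply: eq_integral => x _; rewrite -ge0_integralZr//.
  - by apply: (measurableT_comp mh); exact: pair1_measurable.
  - by rewrite lee_fin normal_pdf_ge0.
rewrite (fubini_tonelli (m1 := leb) (m2 := leb) f mf f0).
rewrite ge0_integral_normal_prob; last 2 first.
- exact/measurable_EFinP.
- by move=> z; rewrite lee_fin.
apply: eq_integral => y _.
have E x : f (x, y) = ((G y * normal_pdf 0 t y)%:E *
    (normal_pdf (s ^+ 2 / t ^+ 2 * y) (s * u / t) x)%:E)%E.
  rewrite -EFinM /f/= -[in LHS](mulrA (G y)) -[in RHS](mulrA (G y)).
  congr EFin; congr (_ * _).
  by rewrite mulrC; exact: normal_pdf_factor.
under eq_integral do rewrite /= E.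
rewrite ge0_integralZl//.
- by rewrite integral_normal_pdf mule1.
- by apply/measurable_EFinP; exact: mpdf.
- by move=> x _; rewrite lee_fin normal_pdf_ge0.
- by rewrite lee_fin mulr_ge0 ?normal_pdf_ge0.
Qed.

(** The second moment of N(0, s^2) is s^2 times this number, by scaling; as it
    is positive and finite, second moments of centered normal laws determine
    s^2. *)
Definition normal_second_moment : \bar R :=
  (\int[normal_prob 0%R 1%R]_x ((x : R) ^+ 2)%:E)%E.

Let sqr_ge0E (x : R) : (0 <= (x ^+ 2)%:E)%E.
Proof. by rewrite lee_fin sqr_ge0. Qed.

Let msqr : measurable_fun [set: R] (fun x : R => (x ^+ 2)%:E).
Proof. by apply/measurable_EFinP; exact: measurable_funX. Qed.

Lemma normal_second_moment_gt0 : (0 < normal_second_moment)%E.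
Proof.
rewrite /normal_second_moment ge0_integral_normal_prob//.
(* on [1, 2] the integrand is at least the density at 2 *)
have p0 : 0 < normal_pdf 0 1 (2 : R).
  by rewrite normal_pdfE ?oner_eq0// mulr_gt0 ?expR_gt0// normal_peak_gt0 ?oner_eq0.
apply: (@lt_le_trans _ _
  (\int[leb]_(x in `[1%R, 2%R]) (cst (normal_pdf 0 1 2)%:E x))%E).
  rewrite integral_cst//= lebesgue_measure_itv/= lte_fin ltr1n/= -EFinD lte_fin.
  by rewrite mulr_gt0//; lra.
apply: (@le_trans _ _
  (\int[leb]_(x in `[1%R, 2%R]) ((x ^+ 2)%:E * (normal_pdf 0 1 x)%:E))%E).
  apply: ge0_le_integral => //=.
  - by move=> x _; rewrite lee_fin ltW.
  - apply: measurable_funTS; apply: emeasurable_funM => //.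
    by apply/measurable_EFinP; exact: measurable_normal_pdf.
  - move=> x; rewrite in_itv/= => /andP[x1 x2]; rewrite -EFinM lee_fin.
    rewrite -[leLHS]mul1r ler_pM ?normal_pdf_ge0//; first by rewrite expr_ge1//; lra.
    rewrite !normal_pdfE ?oner_eq0// ler_wpM2l ?normal_peak_ge0//.
    rewrite /normal_fun ler_expR !subr0 expr1n ler_wpM2r ?invr_ge0// lerN2.
    by rewrite ler_sqr ?nnegrE; lra.
apply: ge0_subset_integral => //.
- apply: emeasurable_funM => //.
  by apply/measurable_EFinP; exact: measurable_normal_pdf.
- by move=> x _; rewrite mule_ge0// lee_fin normal_pdf_ge0.
Qed.

Lemma normal_second_moment_fin_num : normal_second_moment \is a fin_num.
Proof.
rewrite ge0_fin_numE; last exact/ltW/normal_second_moment_gt0.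
rewrite /normal_second_moment ge0_integral_normal_prob//.
(* x^2 <= 4 exp (x^2 / 4) bounds the integrand by a multiple of the density of
   N(0, 2) *)
pose r : R := Num.sqrt 2.
have r2 : r ^+ 2 = 2 by rewrite sqr_sqrtr.
have r0 : r != 0 by rewrite gt_eqF// sqrtr_gt0.
pose C : R := 4 * normal_peak 1 / normal_peak r.
have C0 : 0 <= C by rewrite divr_ge0 ?mulr_ge0 ?normal_peak_ge0.
apply: (@le_lt_trans _ _ (\int[leb]_x (C%:E * (normal_pdf 0 r x)%:E))%E).
  apply: ge0_le_integral => //=.
  - by move=> x _; rewrite mule_ge0// lee_fin normal_pdf_ge0.
  - apply: emeasurable_funM => //.
    by apply/measurable_EFinP; exact: measurable_normal_pdf.
  - apply/measurable_EFinP; apply: measurable_funM => //.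
    exact: measurable_normal_pdf.
  - move=> x _; rewrite -!EFinM lee_fin !normal_pdfE ?oner_eq0//.
    have -> : C * (normal_peak r * normal_fun 0 r x) =
        4 * normal_peak 1 * normal_fun 0 r x.
      by rewrite /C mulrA divfK// gt_eqF// normal_peak_gt0.
    rewrite (mulrC (x ^+ 2)) (mulrC 4) -!mulrA ler_wpM2l ?normal_peak_ge0//.
    rewrite /normal_fun !subr0 r2 expr1n.
    have -> : - x ^+ 2 / (1 *+ 2) = - (x ^+ 2 / 4) - x ^+ 2 / 4 :> R.
      by rewrite -mulr_natr; field.
    have -> : - x ^+ 2 / (2 *+ 2) = - (x ^+ 2 / 4) :> R.
      by rewrite -mulr_natr; field.
    rewrite mulrC expRD mulrA ler_pM2r ?expR_gt0// expRN ler_pdivrMr ?expR_gt0//.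
    by have := expR_ge1Dx (x ^+ 2 / 4); lra.
rewrite ge0_integralZl//.
- by rewrite integral_normal_pdf mule1 ltry.
- by apply/measurable_EFinP; exact: measurable_normal_pdf.
- by move=> x _; rewrite lee_fin normal_pdf_ge0.
Qed.

Lemma normal_prob_sqr s : s != 0 ->
  (\int[normal_prob 0%R s]_x ((x : R) ^+ 2)%:E = normal_second_moment * (s ^+ 2)%:E)%E.
Proof.
move=> s0.
pose r := `|s|.
have r0 : 0 < r by rewrite normr_gt0.
have rE : r ^+ 2 = s ^+ 2 by rewrite real_normK ?num_real.
rewrite /normal_second_moment !ge0_integral_normal_prob//.
under eq_integral do rewrite -EFinM.
rewrite (@ge0_integral_affine 0 r (fun x => x ^+ 2 * normal_pdf 0 s x))//.
- rewrite -ge0_integralZr//.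
  + apply: eq_integral => x _; rewrite -!EFinM; congr EFin.
    rewrite subr0 !normal_pdfE ?oner_eq0// /normal_peak /normal_fun !subr0 exprMn rE.
    rewrite expr1n mul1r -mulrnAr sqrtrM ?sqr_ge0// sqrtr_sqr -/r invfM.
    have -> : - (x ^+ 2 * s ^+ 2) / (s ^+ 2 *+ 2) = - x ^+ 2 / 2.
      by rewrite -mulr_natr; field.
    have -> : 1 *+ 2 = 2 :> R by [].
    by field; rewrite (gt_eqF r0) gt_eqF// sqrtr_gt0 pmulrn_lgt0// pi_gt0.
  + apply: emeasurable_funM => //.
    by apply/measurable_EFinP; exact: measurable_normal_pdf.
  + by move=> x _; rewrite mule_ge0// lee_fin normal_pdf_ge0.
- move=> z; apply: cvgM; last exact: continuous_normal_pdf.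
  exact: sqr_continuous.
- by move=> z; rewrite mulr_ge0 ?normal_pdf_ge0 ?sqr_ge0.
Qed.

End NormalLaw.

(** * Variances and minimum variance along a line *)

Section SquareIntegrable.
Context {R : realType} {d : measure_display} {Omega : measurableType d}.
Variable P : probability Omega R.
Implicit Types X Y : Omega -> R.

Lemma Lfun2_sqr_lty X : measurable_fun [set: Omega] X ->
  (\int[P]_w (X w ^+ 2)%:E < +oo)%E -> X \in Lfun P 2%:E.
Proof.
move=> mX X2; rewrite inE; apply/andP; split; rewrite inE//= /finite_norm unlock.
apply: poweR_lty; apply: le_lt_trans X2.
apply: ge0_le_integral => //=.
- apply/measurable_EFinP.
  apply: (@measurableT_comp _ _ _ _ _ _ (fun x : R => x `^ 2)%R) => //.
  exact: measurableT_comp.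
- by apply/measurable_EFinP; exact: measurable_funX.
- by move=> w _; rewrite lee_fin powR_mulrn// real_normK ?num_real.
Qed.

Lemma variance_integral X :
  ('V_P[X] = \int[P]_w ((X w - fine 'E_P[X]) ^+ 2)%:E)%E.
Proof.
rewrite /variance covariance.unlock.
rewrite [in LHS]expectation.unlock [in RHS]expectation.unlock.
by apply: eq_integral => w _; rewrite expr2.
Qed.

Let Lfun2D X Y : X \in Lfun P 2%:E -> Y \in Lfun P 2%:E -> X \+ Y \in Lfun P 2%:E.
Proof. by move=> X2 Y2; apply: rpredD => //; exact: lee1n. Qed.

Let Lfun2N X : X \in Lfun P 2%:E -> \- X \in Lfun P 2%:E.
Proof. by move=> X2; rewrite rpredN// lee1n. Qed.

Let Lfun2Z (b : R) X : X \in Lfun P 2%:E -> b \o* X \in Lfun P 2%:E.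
Proof. by move=> X2; rewrite Lfun_scale// ler1n. Qed.

Let Lfun2_cst (c : R) : cst c \in Lfun P 2%:E.
Proof. exact: Lfun_cst. Qed.

Lemma Lfun2_variance_lty X : measurable_fun [set: Omega] X ->
  ('V_P[X] < +oo)%E -> X \in Lfun P 2%:E.
Proof.
move=> mX; rewrite variance_integral => V.
set e := fine _ in V.
have : (fun w => X w - e) \in Lfun P 2%:E.
  by apply: Lfun2_sqr_lty => //; exact: measurable_funB.
move=> L; rewrite (_ : X = (fun w => X w - e) \+ cst e); last first.
  by apply/funext => w /=; rewrite subrK.
exact: Lfun2D.
Qed.

Lemma variance_scaled_add (a e e' : R) X Y :
  X \in Lfun P 2%:E -> Y \in Lfun P 2%:E -> e = fine 'E_P[X]%E -> e' = fine 'E_P[Y]%E ->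
  (\int[P]_w ((a * (X w - e) + a * (Y w - e')) ^+ 2)%:E =
   (a ^+ 2)%:E * ('V_P[X] + 'V_P[Y] + 2%:E * covariance P X Y))%E.
Proof.
move=> X2 Y2 eE e'E.
have fP := fin_num_measure P _ (@measurableT _ Omega).
have X1 := Lfun_subset12 fP X2; have Y1 := Lfun_subset12 fP Y2.
rewrite -varianceD// variance_integral expectationD// fineD ?expectation_fin_num//.
rewrite -eE -e'E.
have S2 : X \+ Y \in Lfun P 2%:E by exact: Lfun2D.
have Z2 : (fun w => (X w + Y w) - (e + e')) \in Lfun P 2%:E.
  rewrite (_ : (fun w => _) = (X \+ Y) \+ cst (- (e + e')))//.
  exact: Lfun2D.
have := Lfun2_integrable_sqr Z2 => iZ.
rewrite -ge0_integralZl//.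
- apply: eq_integral => w _ /=; rewrite -EFinM; congr EFin; ring.
- exact: measurable_int iZ.
- by move=> w _; rewrite lee_fin sqr_ge0.
- by rewrite lee_fin sqr_ge0.
Qed.

Lemma variance_scaled_sub (a e e' : R) X Y :
  X \in Lfun P 2%:E -> Y \in Lfun P 2%:E -> e = fine 'E_P[X]%E -> e' = fine 'E_P[Y]%E ->
  (\int[P]_w ((a * (X w - e) - a * (Y w - e')) ^+ 2)%:E =
   (a ^+ 2)%:E * ('V_P[X] + 'V_P[Y] - 2%:E * covariance P X Y))%E.
Proof.
move=> X2 Y2 eE e'E.
have fP := fin_num_measure P _ (@measurableT _ Omega).
have X1 := Lfun_subset12 fP X2; have Y1 := Lfun_subset12 fP Y2.
have N2 : \- Y \in Lfun P 2%:E by exact: Lfun2N.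
have -> : ('V_P[X] + 'V_P[Y] - 2%:E * covariance P X Y =
    'V_P[X] + 'V_P[(\- Y)%R] + 2%:E * covariance P X (\- Y)%R)%E.
  by rewrite varianceN// covarianceNr ?muleN//; exact: Lfun2_mul_Lfun1.
rewrite -(@variance_scaled_add a e (- e') X (\- Y))//; last first.
  have -> : \- Y = -1 \o* Y by apply/funext => w /=; rewrite mulrN1.
  by rewrite expectationZl// fineM ?expectation_fin_num//= -e'E mulN1r.
by apply: eq_integral => w _ /=; congr EFin; ring.
Qed.

(** The variance along the line through X and Y is a quadratic polynomial in
    b whose minimum is at b = 0; its derivative there is 2 (Cov(X, Y) - Var X).
    *)
Lemma covariance_minimum_variance X Y :
  X \in Lfun P 2%:E -> Y \in Lfun P 2%:E ->
  (forall b : R, ('V_P[X] <= 'V_P[fun w => (b * Y w + (1 - b) * X w)%R])%E) ->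
  covariance P X Y = 'V_P[X]%E.
Proof.
move=> X2 Y2 minV.
have fP := fin_num_measure P _ (@measurableT _ Omega).
have X1 := Lfun_subset12 fP X2; have Y1 := Lfun_subset12 fP Y2.
have XY1 := Lfun2_mul_Lfun1 X2 Y2.
have Vb (b : R) : ('V_P[fun w => (b * Y w + (1 - b) * X w)%R] =
    (b ^+ 2)%:E * 'V_P[Y] + ((1 - b) ^+ 2)%:E * 'V_P[X] +
    2%:E * (b%:E * ((1 - b)%:E * covariance P X Y)))%E.
  rewrite (_ : (fun w => _) = (b \o* Y) \+ ((1 - b) \o* X))%R; last first.
    by apply/funext => w /=; rewrite mulrC (mulrC (1 - b)).
  rewrite varianceD; [|exact: Lfun2Z..].
  rewrite !varianceZ// covarianceZl ?Lfun_scale//; last first.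
    by apply: Lfun2_mul_Lfun1 => //; exact: Lfun2Z.
  by rewrite covarianceZr// 1?covarianceC// mulrC.
move: minV; have := Vb.
have := variance_fin_num X2; have := variance_fin_num Y2.
have := covariance_fin_num X1 Y1 XY1.
set v := variance P X; set y := variance P Y; set c := covariance P X Y.
case: c => [c| |]//; case: y => [y| |]//; case: v => [v| |]// _ _ _ VE minV.
have H b : v <= b ^+ 2 * y + (1 - b) ^+ 2 * v + 2 * (b * ((1 - b) * c)).
  by have := minV b; rewrite VE -!EFinM -!EFinD lee_fin.
congr EFin; apply/eqP; rewrite -subr_eq0; apply/eqP.
pose D := y + v - 2 * c; pose e := c - v.
have {}H b : 0 <= b ^+ 2 * D + 2 * b * e by have := H b; rewrite /D /e; nra.
(* D b^2 + 2 e b >= 0 for all b forces e = 0: take b = - e / (D + 1) *)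
have D0 : 0 <= D by have := H 1; have := H (-1); lra.
apply/eqP; rewrite -sqrf_eq0 eq_le sqr_ge0 andbT -/e.
apply/negPn/negP; rewrite -ltNge => e0.
have := H (- e / (D + 1)).
have -> : (- e / (D + 1)) ^+ 2 * D + 2 * (- e / (D + 1)) * e =
    - (e ^+ 2 * (D + 2) / (D + 1) ^+ 2) by field; rewrite gt_eqF//; lra.
rewrite oppr_ge0 leNgt divr_gt0//; last by rewrite exprn_gt0//; lra.
by rewrite mulr_gt0//; lra.
Qed.

End SquareIntegrable.

(** * Lower semicontinuity under weak convergence *)

(** Truncating h at height M makes it a bounded continuous test function; the
    bound L holds for each truncation, hence for h by monotone convergence. *)
Lemma weakly_convergent_integral_le {R : realType} {E : topologicalType}
    {d : nat -> measure_display} {Omega : forall n, measurableType (d n)}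
    (P : forall n, probability (Omega n) R) (X : forall n, Omega n -> E)
    {d' : measure_display} {Omega' : measurableType d'}
    (Q : probability Omega' R) (Y : Omega' -> E)
    (h : E -> R) (l : nat -> \bar R) (L : \bar R) :
  weakly_convergent P X Q Y -> continuous h -> (forall x, 0 <= h x) ->
  (forall n, measurable_fun [set: Omega n] (h \o X n)) ->
  measurable_fun [set: Omega'] (h \o Y) ->
  (forall n, (\int[P n]_w (h (X n w))%:E <= l n)%E) -> l n @[n --> \oo] --> L ->
  (\int[Q]_w (h (Y w))%:E <= L)%E.
Proof.
move=> wc ch h0 mX mY hl lL.
pose g (M : nat) (x : E) : R := Num.min (h x) M%:R.
have g0 M x : 0 <= g M x by rewrite le_min h0/=.
have mgY M : measurable_fun [set: Omega'] (fun w => (g M (Y w))%:E).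
  by apply/measurable_EFinP; apply: measurable_minr.
have gL (M : nat) : (\int[Q]_w (g M (Y w))%:E <= L)%E.
  have cg : continuous (g M).
    move=> x; apply: (@continuous_min _ _ h (cst M%:R)); first exact: ch.
    exact: cvg_cst.
  have gM : exists N : R, forall x, `|g M x| <= N.
    by exists M%:R => x; rewrite ger0_norm// ge_min lexx orbT.
  have := wc _ cg gM; rewrite expectation.unlock => wcg.
  apply: (lee_cvg_to wcg lL); apply: nearW => n.
  apply: le_trans (hl n); apply: ge0_le_integral => //=.
  - by move=> w _; rewrite lee_fin.
  - by apply/measurable_EFinP; apply: (measurable_minr (mX n)).
  - exact/measurable_EFinP/mX.
  - by move=> w _; rewrite lee_fin ge_min lexx.
have gE w : (h (Y w))%:E = limn (fun M => (g M (Y w))%:E).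
  apply/esym/cvg_lim => //; apply: cvg_near_cst; near=> M.
  by rewrite /g min_l//; near: M; exact: nbhs_infty_ger.
under eq_integral do rewrite gE.
have ndg w : {homo (fun M => (g M (Y w))%:E) : M N / (M <= N)%N >-> (M <= N)%E}.
  move=> M N MN; rewrite lee_fin /g le_min !ge_min lexx/=.
  by apply/orP; right; rewrite ler_nat.
rewrite monotone_convergence//; last by move=> M w _; rewrite lee_fin.
apply: lime_le; last exact: nearW.
apply: ereal_nondecreasing_is_cvgn => M N MN; apply: ge0_le_integral => //.
- by move=> w _; rewrite lee_fin.
- by move=> w _; exact: ndg.
Unshelve. all: by end_near. Qed.

Lemma eq_normal_prob {R : realType} (s t : R) (A : set (measurableTypeR R)) :
  s != 0 -> s ^+ 2 = t ^+ 2 -> normal_prob 0 s A = normal_prob 0 t A.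
Proof.
move=> s0 st; have t0 : t != 0 by rewrite -sqrf_eq0 -st sqrf_eq0.
rewrite /normal_prob; apply: eq_integral => x _.
by rewrite !normal_pdfE// /normal_peak /normal_fun st.
Qed.

(** * Centered Gaussian pairs *)

Section CenteredNormal.
Context {R : realType} {d : measure_display} {Omega : measurableType d}.
Variable Q : probability Omega R.
Implicit Types (X Y : Omega -> R) (s t u : R).

(** [normal_prob] is a measure on [measurableTypeR R]; the canonical measurable
    structure of [R] has the same measurable sets but another display, hence
    the explicit codomain. *)
Lemma eq_integral_pushforward (X : Omega -> measurableTypeR R)
    (nu : {measure set (measurableTypeR R) -> \bar R})
    (f : measurableTypeR R -> \bar R) :
  measurable_fun [set: Omega] X ->
  (forall B, measurable B -> pushforward Q X B = nu B) ->
  (\int[pushforward Q X]_x f x = \int[nu]_x f x)%E.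
Proof.
move=> mX XE.
pose X' : {mfun Omega >-> measurableTypeR R} :=
  HB.pack X (isMeasurableFun.Build _ _ _ _ _ mX).
apply: (@eq_measure_integral _ _ _ setT nu (distribution Q X')) => A mA _.
exact: XE.
Qed.

Definition normal_law X s : Prop := forall B : set R, measurable B ->
  pushforward Q X B = if s == 0 then \d_(0 : R) B else normal_prob 0 s B.

Let measurable_funR X : measurable_fun [set: Omega] X ->
  measurable_fun [set: Omega] (X : Omega -> measurableTypeR R).
Proof. by []. Qed.

Lemma ge0_integral_normal_law X s (f : R -> \bar R) :
  measurable_fun [set: Omega] X -> normal_law X s ->
  measurable_fun [set: R] f -> (forall x, 0 <= f x)%E ->
  (\int[Q]_w f (X w) = if s == 0%R then f 0%R else \int[normal_prob 0%R s]_x f x)%E.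
Proof.
move=> mX lX mf f0.
have {}mf : measurable_fun [set: measurableTypeR R] f by [].
rewrite -[LHS](ge0_integral_pushforward (measurable_funR mX) Q measurableT mf)//.
have [s0|s0] := eqVneq s 0.
  rewrite (eq_integral_pushforward (nu := \d_(0 : measurableTypeR R)) _
             (measurable_funR mX)).
    by rewrite integral_dirac// diracT mul1e.
  by move=> B mB; have := lX B mB; rewrite s0 eqxx.
apply: (eq_integral_pushforward _ (measurable_funR mX)) => B mB.
by have := lX B mB; rewrite (negbTE s0).
Qed.

Lemma normal_law_sqr X s : measurable_fun [set: Omega] X -> normal_law X s ->
  (\int[Q]_w (X w ^+ 2)%:E = normal_second_moment * (s ^+ 2)%:E)%E.
Proof.
move=> mX lX.
rewrite (ge0_integral_normal_law (f := fun x => (x ^+ 2)%:E) mX lX).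
- have [->|s0] := eqVneq s 0; first by rewrite expr0n mule0.
  exact: normal_prob_sqr.
- by apply/measurable_EFinP; exact: measurable_funX.
- by move=> x; rewrite lee_fin sqr_ge0.
Qed.

Lemma normal_law_Lfun2 X s : measurable_fun [set: Omega] X -> normal_law X s ->
  X \in Lfun Q 2%:E.
Proof.
move=> mX lX; apply: Lfun2_sqr_lty => //.
by rewrite (normal_law_sqr mX lX) ltey_eq fin_numM// normal_second_moment_fin_num.
Qed.

Lemma normal_law_sqr_inj X Y s t :
  measurable_fun [set: Omega] X -> measurable_fun [set: Omega] Y ->
  normal_law X s -> normal_law Y t ->
  (\int[Q]_w (X w ^+ 2)%:E = \int[Q]_w (Y w ^+ 2)%:E)%E -> s ^+ 2 = t ^+ 2.
Proof.
move=> mX mY lX lY; rewrite (normal_law_sqr mX lX) (normal_law_sqr mY lY).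
have := @normal_second_moment_fin_num R; have := @normal_second_moment_gt0 R.
case: normal_second_moment => // c; rewrite lte_fin => c0 _.
by rewrite -!EFinM => -[] /(mulfI (lt0r_neq0 c0)).
Qed.

Lemma normal_law_eq_sqr X s t : s ^+ 2 = t ^+ 2 -> normal_law X s -> normal_law X t.
Proof.
move=> st lX B mB; rewrite (lX B mB).
have <- : (s == 0) = (t == 0) by rewrite -sqrf_eq0 st sqrf_eq0.
by have [_|s0] := eqVneq s 0; [exact: erefl|exact: eq_normal_prob].
Qed.

(** X and - X have the same second moment, hence the same parameter and the
    same law, so that E X = - E X. *)
Lemma normal_law_mean0 X s t : measurable_fun [set: Omega] X ->
  normal_law X s -> normal_law (fun w => - X w) t -> 'E_Q[X]%E = 0%E.
Proof.
move=> mX lX lN.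
have mN : measurable_fun [set: Omega] (fun w => - X w) by exact: measurableT_comp.
have X2 := normal_law_Lfun2 mX lX.
have X1 : X \in Lfun Q 1 by exact: (Lfun_subset12 (fin_num_measure Q _ measurableT)).
have iX : Q.-integrable [set: Omega] (EFin \o X) by exact/Lfun1_integrable.
have lNs : normal_law (fun w => - X w) s.
  apply: (normal_law_eq_sqr _ lN).
  apply: (normal_law_sqr_inj mN mX lN lX).
  by apply: eq_integral => w _; rewrite sqrrN.
have iN : Q.-integrable [set: Omega] (EFin \o (fun w => - X w)).
  rewrite (_ : EFin \o _ = (fun w => - (EFin \o X) w)%E)//; exact: integrableN.
have EN : 'E_Q[X]%E = 'E_Q[fun w => (- X w)%R]%E.
  rewrite expectation.unlock.
  pose N : {mfun Omega >-> measurableTypeR R} :=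
    HB.pack (fun w => - X w : measurableTypeR R)
            (isMeasurableFun.Build _ _ _ _ _ (measurable_funR mN)).
  have mE : measurable_fun [set: measurableTypeR R]
      (EFin : measurableTypeR R -> \bar R).
    by apply/(measurable_EFinP _ id).
  have := @eq_integral_pushforward X (distribution Q N) EFin (measurable_funR mX).
  rewrite (integral_pushforward (measurable_funR mX) mE iX measurableT).
  rewrite (integral_pushforward (measurable_funR mN) mE iN measurableT) !preimage_setT.
  by apply => B mB; exact: etrans (lX B mB) (esym (lNs B mB)).
have EX := expectation_fin_num X1.
have : 'E_Q[X]%E = (- 'E_Q[X])%E.
  rewrite {1}EN (_ : (fun w => - X w) = -1 \o* X)%R; last first.
    by apply/funext => w /=; rewrite mulrN1.
  by rewrite expectationZl// EFinN mulNe mul1e.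
move: EX; case: ('E_Q[X])%E => // e _ [] => H; congr EFin; lra.
Qed.

Lemma normal_law_convolution X Y Z s u t (G : R -> R) :
  measurable_fun [set: Omega] X -> measurable_fun [set: Omega] Y ->
  measurable_fun [set: Omega] Z ->
  normal_law X s -> normal_law Y u -> normal_law Z t ->
  t ^+ 2 = s ^+ 2 + u ^+ 2 -> continuous G -> (forall x, 0 <= G x) ->
  (\int[Q]_w \int[Q]_w' (G (X w + Y w'))%:E = \int[Q]_w (G (Z w))%:E)%E.
Proof.
move=> mX mY mZ lX lY lZ tE cG G0.
have mG : measurable_fun [set: R] G by exact: continuous_measurable_fun.
have GE x : (0 <= (G x)%:E)%E by rewrite lee_fin.
have mGx x : measurable_fun [set: R] (fun y => (G (x + y))%:E).
  by apply/measurable_EFinP; apply: measurableT_comp => //; exact: measurable_funD.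
have mGE : measurable_fun [set: R] (fun x => (G x)%:E) by exact/measurable_EFinP.
rewrite (ge0_integral_normal_law mZ lZ mGE GE).
pose H x := (\int[Q]_w' (G (x + Y w'))%:E)%E.
have mH : measurable_fun [set: R] H.
  apply: (measurable_fun_fubini_tonelli_F (m2 := Q)
    (fun z : R * Omega => (G (z.1 + Y z.2))%:E)) => //.
  apply/measurable_EFinP; apply: measurableT_comp => //.
  by apply: measurable_funD => //; exact: measurableT_comp.
rewrite (ge0_integral_normal_law (f := H) mX lX mH); last first.
  by move=> x; exact: integral_ge0.
have HE x : H x = (if u == 0%R then (G x)%:E
                   else \int[normal_prob 0%R u]_y (G (x + y)%R)%:E)%E.
  rewrite /H (ge0_integral_normal_law mY lY (mGx x)); first by rewrite addr0.
  by move=> y.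
have [s0|s0] := eqVneq s 0; have [u0|u0] := eqVneq u 0.
- have -> : t == 0 by rewrite -sqrf_eq0 tE s0 u0 expr0n addr0.
  by rewrite HE u0 eqxx.
- have tu : t ^+ 2 = u ^+ 2 by rewrite tE s0 expr0n add0r.
  have t0 : t != 0 by rewrite -sqrf_eq0 tu sqrf_eq0.
  rewrite HE (negbTE u0) (negbTE t0); under eq_integral do rewrite add0r.
  by apply: eq_measure_integral => A _ _; exact: eq_normal_prob.
- have ts : t ^+ 2 = s ^+ 2 by rewrite tE u0 expr0n addr0.
  have t0 : t != 0 by rewrite -sqrf_eq0 ts sqrf_eq0.
  rewrite (negbTE t0); transitivity (\int[normal_prob 0%R s]_x (G x)%:E)%E.
    by apply: eq_integral => x _; rewrite HE u0 eqxx.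
  by apply: eq_measure_integral => A _ _; exact: eq_normal_prob.
have t0 : t != 0.
  rewrite -sqrf_eq0 tE gt_eqF// addr_gt0// exprn_even_gt0//.
rewrite (negbTE t0)/= -(normal_prob_convolution s0 u0 tE cG G0).
by apply: eq_integral => x _; rewrite HE (negbTE u0).
Qed.

Lemma centered_gaussian_pair_Lfun2 X Y :
  measurable_fun [set: Omega] X -> measurable_fun [set: Omega] Y ->
  centered_gaussian_pair Q X Y -> X \in Lfun Q 2%:E /\ Y \in Lfun Q 2%:E.
Proof.
move=> mX mY gXY; split.
  have [s lX] := gXY 1 0; apply: (@normal_law_Lfun2 X s) => //.
  by move: lX; under eq_fun do rewrite mul1r mul0r addr0.
have [t lY] := gXY 0 1; apply: (@normal_law_Lfun2 Y t) => //.
by move: lY; under eq_fun do rewrite mul1r mul0r add0r.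
Qed.

(** The left-hand sides of the two moment bounds add up to 2 Var X + 2 Var Y
    by the parallelogram identity, as do the right-hand sides.  So the bounds
    are equalities, and Var(Y - X) = Var Y - Var X. *)
Lemma gaussian_pair_convolution X Y (G : R -> R) :
  measurable_fun [set: Omega] X -> measurable_fun [set: Omega] Y ->
  centered_gaussian_pair Q X Y ->
  (\int[Q]_w ((X w + Y w) ^+ 2)%:E <= 3%:E * 'V_Q[X] + 'V_Q[Y])%E ->
  (\int[Q]_w ((X w - Y w) ^+ 2)%:E <= 'V_Q[Y] - 'V_Q[X])%E ->
  continuous G -> (forall x, 0 <= G x) ->
  (\int[Q]_w \int[Q]_w' (G (X w + (Y w' - X w')))%:E = \int[Q]_w (G (Y w))%:E)%E.
Proof.
move=> mX mY gXY Hp Hm cG G0.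
have comb a b Z : (forall w, Z w = a * X w + b * Y w) ->
    measurable_fun [set: Omega] Z /\ exists s, normal_law Z s.
  move=> /funext ->; split; last exact: gXY.
  by apply: measurable_funD; exact: measurable_funM.
have [_ [s lX]] := comb 1 0 X (fun w => ltac:(ring)).
have [_ [s' lNX]] := comb (-1) 0 (fun w => - X w) (fun w => ltac:(ring)).
have [_ [t lY]] := comb 0 1 Y (fun w => ltac:(ring)).
have [_ [t' lNY]] := comb 0 (-1) (fun w => - Y w) (fun w => ltac:(ring)).
have [mU [u lU]] := comb (-1) 1 (fun w => Y w - X w) (fun w => ltac:(ring)).
have [mP [v lP]] := comb 1 1 (fun w => X w + Y w) (fun w => ltac:(ring)).
apply: (normal_law_convolution mX mU mY lX lU lY) => //.
have VX : 'V_Q[X]%E = (\int[Q]_w (X w ^+ 2)%:E)%E.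
  rewrite variance_integral (normal_law_mean0 mX lX lNX)/=.
  by under eq_integral do rewrite subr0.
have VY : 'V_Q[Y]%E = (\int[Q]_w (Y w ^+ 2)%:E)%E.
  rewrite variance_integral (normal_law_mean0 mY lY lNY)/=.
  by under eq_integral do rewrite subr0.
have msqr (Z : Omega -> R) : measurable_fun [set: Omega] Z ->
    measurable_fun [set: Omega] (fun w => (Z w ^+ 2)%:E).
  by move=> mZ; apply/measurable_EFinP; exact: measurable_funX.
have parallelogram : (\int[Q]_w ((X w + Y w) ^+ 2)%:E +
      \int[Q]_w ((Y w - X w) ^+ 2)%:E =
    2%:E * \int[Q]_w (X w ^+ 2)%:E + 2%:E * \int[Q]_w (Y w ^+ 2)%:E)%E.
  rewrite -!ge0_integralZl//; try exact: msqr.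
  rewrite -!ge0_integralD//; try exact: msqr.
  - by apply: eq_integral => w _; rewrite -!EFinM -!EFinD; congr EFin; ring.
  - by move=> w _; rewrite mule_ge0// lee_fin sqr_ge0.
  - by apply: emeasurable_funM => //; exact: msqr.
  - by move=> w _; rewrite mule_ge0// lee_fin sqr_ge0.
  - by apply: emeasurable_funM => //; exact: msqr.
  - by move=> w _; rewrite lee_fin sqr_ge0.
  - by move=> w _; rewrite lee_fin sqr_ge0.
  - by move=> w _; rewrite lee_fin sqr_ge0.
  - by move=> w _; rewrite lee_fin sqr_ge0.
move: Hm.
have -> : (\int[Q]_w ((X w - Y w) ^+ 2)%:E =
           \int[Q]_w ((Y w - X w) ^+ 2)%:E)%E.
  by apply: eq_integral => w _; congr EFin; ring.
move: Hp parallelogram; rewrite VX VY.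
rewrite (normal_law_sqr mX lX) (normal_law_sqr mY lY).
rewrite (normal_law_sqr mP lP) (normal_law_sqr mU lU).
have := @normal_second_moment_fin_num R; have := @normal_second_moment_gt0 R.
case: normal_second_moment => // c; rewrite lte_fin => c0 _.
rewrite -!EFinM -!EFinD !lee_fin => Hp [] par Hm.
apply: (mulfI (lt0r_neq0 c0)); lra.
Qed.

End CenteredNormal.

(** * Functionals of estimators *)

Section ScalarFunctions.
Context {R : realType} {W : lmodType R} (f : W -> R^o).
Hypothesis linf : scalar f.

Lemma scalar_funD u v : f (u + v) = f u + f v.
Proof. by rewrite -[u]scale1r linf !scale1r mul1r. Qed.

Lemma scalar_funZ (r : R) u : f (r *: u) = r * f u.
Proof.
have f0 : f 0 = 0.
  by apply: (addrI (f 0)); rewrite -scalar_funD !addr0.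
by rewrite -[r *: u]addr0 linf f0 addr0.
Qed.

Lemma scalar_funB u v : f (u - v) = f u - f v.
Proof. by rewrite scalar_funD -scaleN1r scalar_funZ mulN1r. Qed.

End ScalarFunctions.

Section MinimumVariance.
Context {R : realType} {W : lmodType R} (I : set (W -> R^o)).
Context {d : measure_display} {Omega : measurableType d} (P : probability Omega R).

Lemma measurable_functional {d'} {Omega' : measurableType d'}
    (f : W -> R^o) (T : Omega' -> W) :
  I f -> measurable_fun [set: Omega'] (T : Omega' -> sigmaW I) ->
  measurable_fun [set: Omega'] (f \o T : Omega' -> R).
Proof.
move=> If mT; apply: (measurableT_comp _ mT) => _ B mB.
by rewrite setTI; apply: sub_sigma_algebra; exists f => //; exists B.
Qed.

Lemma measurable_to_sigmaW {d'} {Omega' : measurableType d'} (T : Omega' -> W) :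
  (forall f, I f -> measurable_fun [set: Omega'] (f \o T : Omega' -> R)) ->
  measurable_fun [set: Omega'] (T : Omega' -> sigmaW I).
Proof.
move=> mT; apply: (@measurability _ _ _ _ _ _
  (functional_preimages I : set (set (sigmaW I)))) => //.
move=> _ [_ [f If [B mB ->]] <-].
by have := mT f If measurableT B mB.
Qed.

(** Both identities follow from Cov(f(S), f(T)) = Var(f(S)).  They are stated
    for the centered and rescaled variables of the weak convergence hypothesis,
    with right-hand sides in terms of the variances that converge. *)
Lemma minimum_variance_second_moments (gamma : W) (K : set (Omega -> W))
    (S T : Omega -> W) (f : W -> R^o) (r : R) :
  assumption_A I P gamma K -> minimum_variance_estimator I P K S -> K T ->
  I f -> scalar f ->
  let X w := r * (f (S w) - fine 'E_P[f \o S]%E) in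
  let Y w := r * (f (T w) - fine 'E_P[f \o T]%E) in
  [/\ measurable_fun [set: Omega] X, measurable_fun [set: Omega] Y,
   (\int[P]_w ((X w + Y w) ^+ 2)%:E =
      3%:E * 'V_P[fun w => (r * f (S w))%R] + 'V_P[fun w => (r * f (T w))%R])%E &
   (\int[P]_w ((X w - Y w) ^+ 2)%:E =
      'V_P[fun w => (r * f (T w))%R] - 'V_P[fun w => (r * f (S w))%R])%E].
Proof.
move=> [AK convK] [KS minS] KT If linf.
have L2 U : K U ->
    measurable_fun [set: Omega] (f \o U : Omega -> R) /\ f \o U \in Lfun P 2%:E.
  move=> /AK [eU _ vU]; have mU := measurable_functional If eU; split=> //.
  exact: Lfun2_variance_lty (vU f If).
have [mS S2] := L2 S KS; have [mT T2] := L2 T KT.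
have cov : covariance P (f \o S) (f \o T) = 'V_P[f \o S]%E.
  apply: covariance_minimum_variance => // b.
  have := minS f If _ (convK b _ _ KT KS).
  rewrite (_ : f \o (fun w => b *: T w + (1 - b) *: S w) =
    fun w => b * f (T w) + (1 - b) * f (S w))//.
  apply/funext => w /=; rewrite linf; congr (_ + _).
  exact: scalar_funZ.
have VZ (U : Omega -> W) : f \o U \in Lfun P 2%:E ->
    'V_P[fun w => (r * f (U w))%R]%E = ((r ^+ 2)%:E * 'V_P[f \o U])%E.
  move=> U2; rewrite -varianceZ// (_ : (fun w => r * f (U w)) = r \o* (f \o U))//.
  by apply/funext => w /=; rewrite mulrC.
split.
- by apply: measurable_funM => //; exact: measurable_funB.
- by apply: measurable_funM => //; exact: measurable_funB.
- rewrite (variance_scaled_add _ S2 T2)// cov !VZ//.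
  have := variance_fin_num S2; have := variance_fin_num T2.
  case: variance => [y| |]//; case: variance => [x| |]// _ _.
  by rewrite -?EFinM -?EFinD -?EFinM -?EFinD; congr EFin; ring.
- rewrite (variance_scaled_sub _ S2 T2)// cov !VZ//.
  have := variance_fin_num S2; have := variance_fin_num T2.
  case: variance => [y| |]//; case: variance => [x| |]// _ _.
  by rewrite -?EFinM -?EFinD -?EFinM -?EFinD; congr EFin; ring.
Qed.

End MinimumVariance.

(** * From the functionals to laws on W *)

(** Adding 1 to the cosine gives nonnegative integrands, to which Tonelli's
    theorem and the convolution of normal laws apply. *)
Lemma Rintegral_cos_1Dcos {R : realType} {d : measure_display} {T : measurableType d}
    (mu : probability T R) (h : T -> R) (c : R) : measurable_fun [set: T] h ->
  (\int[mu]_x (1 + cos (h x + c))%:E = (1 + \int[mu]_x cos (h x + c))%R%:E)%E.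
Proof.
move=> mh.
have bc := bounded_measurable_cos c mh.
have ic := bounded_measurable_integrable mu bc.
have i1 := bounded_measurable_integrable mu (bounded_measurable_cst (1 : R)).
rewrite -[LHS]fineK; last first.
  apply: integrable_fin_num => //; apply: (bounded_measurable_integrable mu).
  by apply: bounded_measurableD => //; exact: bounded_measurable_cst.
rewrite [fine _](RintegralD measurableT i1 ic) Rintegral_cst//.
by rewrite [X in fine X](probability_setT mu) mulr1.
Qed.

(** By linearity of f, the image by f of the convolution of two laws is the
    convolution of their images, so the hypothesis says that the two measures
    have the same trigonometric integrals ([eq_measure_trig]). *)
Lemma convolution_of_projections {R : realType} {W : lmodType R} (I : set (W -> R^o))
    {d : measure_display} {Omega : measurableType d} (Q : probability Omega R)
    (T S U : Omega -> W) :
  linear_functional_space I ->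
  measurable_fun [set: Omega] (T : Omega -> sigmaW I) ->
  measurable_fun [set: Omega] (S : Omega -> sigmaW I) ->
  measurable_fun [set: Omega] (U : Omega -> sigmaW I) ->
  (forall f c, I f ->
     (\int[Q]_w \int[Q]_w' (1 + cos (f (S w) + f (U w') + c))%R%:E =
      \int[Q]_w (1 + cos (f (T w) + c))%R%:E)%E) ->
  forall A : set (sigmaW I), measurable A ->
    pushforward Q (T : Omega -> sigmaW I) A =
    convolution (pushforward Q (S : Omega -> sigmaW I))
                (pushforward Q (U : Omega -> sigmaW I)) A.
Proof.
move=> [[I0 Ilin] Iscalar] mT mS mU cosE.
pose T' : {mfun Omega >-> sigmaW I} :=
  HB.pack (T : Omega -> sigmaW I) (isMeasurableFun.Build _ _ _ _ _ mT).
pose S' : {mfun Omega >-> sigmaW I} :=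
  HB.pack (S : Omega -> sigmaW I) (isMeasurableFun.Build _ _ _ _ _ mS).
pose U' : {mfun Omega >-> sigmaW I} :=
  HB.pack (U : Omega -> sigmaW I) (isMeasurableFun.Build _ _ _ _ _ mU).
pose mu := distribution Q T'.
pose muS := distribution Q S'.
pose muU := distribution Q U'.
have mf (f : W -> R^o) : I f -> measurable_fun [set: sigmaW I] (f : sigmaW I -> R).
  by move=> If; exact: (measurable_functional If (@measurable_id _ (sigmaW I) setT)).
pose plus (z : sigmaW I * sigmaW I) : sigmaW I := (z.1 : W) + (z.2 : W).
have mplus : measurable_fun [set: sigmaW I * sigmaW I] plus.
  apply: (measurable_to_sigmaW (T := plus)) => f If.
  rewrite (_ : f \o plus = fun z => f z.1 + f z.2).
    by apply: measurable_funD; (apply: measurableT_comp; [exact: mf|]).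
  by apply/funext => z /=; exact: (scalar_funD (Iscalar _ If)).
have prod1 : (muS \x muU)%E [set: sigmaW I * sigmaW I] = 1%E.
  rewrite -setXTT product_measure1E// [X in (X * _)%E](probability_setT muS).
  by rewrite [X in (_ * X)%E](probability_setT muU) mule1.
pose rho : probability (sigmaW I * sigmaW I)%type R :=
  HB.pack (muS \x muU)%E (Measure_isProbability.Build _ _ _ (muS \x muU)%E prod1).
pose plus' : {mfun (sigmaW I * sigmaW I)%type >-> sigmaW I} :=
  HB.pack plus (isMeasurableFun.Build _ _ _ _ _ mplus).
pose nu := distribution rho plus'.
suff H : forall A : set (sigmaW I), measurable A -> mu A = nu A by exact: H.
apply: (@eq_measure_trig _ _ _ mu nu (I : set (sigmaW I -> R)) mf _ _ (cst 0)).
- move=> f g If Ig; have := Ilin 1 f g (mem_set If) (mem_set Ig) => /set_mem.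
  by congr I; apply/funext => x /=; rewrite scale1r.
- move=> r f If; have := Ilin r f 0 (mem_set If) I0 => /set_mem.
  by congr I; apply/funext => x /=; rewrite addr0.
- exact: set_mem I0.
move=> f c If.
pose G (x : R) := (1 + cos (x + c))%:E : \bar R.
have G0 x : (0 <= G x)%E by rewrite lee_fin; have := cos_geN1 (x + c); lra.
have mG : measurable_fun [set: R] G.
  apply/measurable_EFinP; apply: measurable_funD => //.
  exact: (bounded_measurable_cos c (@measurable_id _ R setT)).1.
have mGf : measurable_fun [set: sigmaW I] (fun x : sigmaW I => G (f x)).
  by apply: measurableT_comp mG _; exact: mf.
suff : (\int[mu]_x G (f x) = \int[nu]_x G (f x))%E.
  rewrite /G (Rintegral_cos_1Dcos mu c (mf _ If)) (Rintegral_cos_1Dcos nu c (mf _ If)).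
  by move=> [] /addrI.
rewrite (ge0_integral_distribution T' mGf)//= -cosE//.
rewrite (ge0_integral_distribution plus' mGf)//=.
pose h (z : sigmaW I * sigmaW I) := G (f (plus z)).
have mh : measurable_fun [set: sigmaW I * sigmaW I] h.
  by exact: measurableT_comp mGf mplus.
have h0 z : (0 <= h z)%E by exact: G0.
transitivity (\int[muS]_x \int[muU]_y h (x, y))%E; last first.
  by rewrite -(fubini_tonelli1 (m1 := muS) (m2 := muU) h mh h0).
have mF : measurable_fun [set: sigmaW I] (fun x => \int[muU]_y h (x, y))%E.
  exact: (measurable_fun_fubini_tonelli_F (m2 := muU) h mh h0).
rewrite (ge0_integral_distribution S' mF); last first.
  by move=> x; exact: integral_ge0.
apply: eq_integral => w _ /=.
have mhw : measurable_fun [set: sigmaW I] (fun y => h (S w, y)).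
  exact: measurableT_comp mh (pair1_measurable _).
rewrite (ge0_integral_distribution U' mhw)//.
apply: eq_integral => w' _ /=; rewrite /h /G /plus/=.
by rewrite (scalar_funD (Iscalar _ If)).
Qed.

(** * The convolution theorem *)

Theorem theorem9 (R : realType) (W : lmodType R)
  (I : set (W -> R^o)) (hI : linear_functional_space I)
  (Theta : Type)
  (d : nat -> measure_display) (Omega : forall n, measurableType (d n))
  (P : forall n, Theta -> probability (Omega n) R)
  (g : nat -> Theta -> W) (theta0 : Theta)
  (K : forall n, set (Omega n -> W))
  (hK : forall n, assumption_A I (P n theta0) (g n theta0) (K n))
  (Sn : forall n, Omega n -> W)
  (hSn : forall n, minimum_variance_estimator I (P n theta0) (K n) (Sn n))
  (Tn : forall n, Omega n -> W) (hTn : forall n, K n (Tn n))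
  (a : nat -> R) (ha : forall n, 0 < a n)
  (d' : measure_display) (Omega' : measurableType d') (Q : probability Omega' R)
  (S T : Omega' -> W)
  (hS : measurable_fun [set: Omega'] (S : Omega' -> sigmaW I))
  (hT : measurable_fun [set: Omega'] (T : Omega' -> sigmaW I))
  (hcvg : forall f, I f ->
    weakly_convergent (E := (R * R)%type) (fun n => P n theta0)
      (fun n w =>
        (a n * (f (Sn n w) - fine ('E_(P n theta0)[f \o Sn n])%E),
         a n * (f (Tn n w) - fine ('E_(P n theta0)[f \o Tn n])%E)))
      Q (fun w => (f (S w), f (T w))))
  (hgauss : forall f, I f -> centered_gaussian_pair Q (f \o S) (f \o T))
  (hvarS : forall f, I f ->
    'V_(P n theta0)[(fun w => a n * f (Sn n w))%R]%E @[n --> \oo]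
      --> 'V_Q[f \o S]%E)
  (hvarT : forall f, I f ->
    'V_(P n theta0)[(fun w => a n * f (Tn n w))%R]%E @[n --> \oo]
      --> 'V_Q[f \o T]%E) :
  forall A : set (sigmaW I), measurable A ->
    pushforward Q (T : Omega' -> sigmaW I) A =
    convolution (pushforward Q (S : Omega' -> sigmaW I))
                (pushforward Q ((fun w => T w - S w) : Omega' -> sigmaW I)) A.
Proof.
have linI f : I f -> scalar f := hI.2 f.
have mU : measurable_fun [set: Omega'] ((fun w => T w - S w) : Omega' -> sigmaW I).
  apply: measurable_to_sigmaW => f If.
  rewrite (_ : f \o _ = (fun w => f (T w) - f (S w))).
    apply: measurable_funB; first exact: (measurable_functional If hT).
    exact: (measurable_functional If hS).
  by apply/funext => w /=; exact: (scalar_funB (linI f If)).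
apply: (convolution_of_projections hI hT hS mU) => f c If.
have mS := measurable_functional If hS; have mT := measurable_functional If hT.
have gST := hgauss f If.
pose G (x : R) : R := 1 + cos (x + c).
have cG : continuous G.
  move=> x; apply: cvgD; first exact: cvg_cst.
  apply: (continuous_comp (f := fun x => x + c)); last exact: continuous_cos.
  by apply: cvgD; [exact: cvg_id|exact: cvg_cst].
have G0 x : 0 <= G x by rewrite /G; have := cos_geN1 (x + c); lra.
have VS := variance_fin_num (centered_gaussian_pair_Lfun2 mS mT gST).1.
have VT := variance_fin_num (centered_gaussian_pair_Lfun2 mS mT gST).2.
have moments n := minimum_variance_second_moments (a n) (hK n) (hSn n) (hTn n)
  If (linI f If).
rewrite -(gaussian_pair_convolution (G := G) mS mT gST)//.
- apply: eq_integral => w _; apply: eq_integral => w' _.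
  by rewrite /G/= (scalar_funB (linI f If)).
- pose l n := (3%:E * 'V_(P n theta0)[fun w => (a n * f (Sn n w))%R] +
              'V_(P n theta0)[fun w => (a n * f (Tn n w))%R])%E.
  apply: (weakly_convergent_integral_le (h := fun z : R * R => (z.1 + z.2) ^+ 2)
           (l := l) (hcvg f If)).
  + move=> z; have cz : z'.1 + z'.2 @[z' --> z] --> z.1 + z.2.
      by apply: cvgD; [exact: cvg_fst|exact: cvg_snd].
    exact: (cvgM cz cz).
  + by move=> z; exact: sqr_ge0.
  + move=> n; have [mX mY _ _] := moments n.
    by apply: measurable_funX; exact: measurable_funD.
  + by apply: measurable_funX; exact: measurable_funD.
  + by move=> n; have [_ _ -> _] := moments n.
  + apply: cvgeD.
    * by rewrite fin_num_adde_defl.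
    * by apply: cvgeZl => //; exact: hvarS.
    * exact: hvarT.
- pose l n := ('V_(P n theta0)[fun w => (a n * f (Tn n w))%R] -
              'V_(P n theta0)[fun w => (a n * f (Sn n w))%R])%E.
  apply: (weakly_convergent_integral_le (h := fun z : R * R => (z.1 - z.2) ^+ 2)
           (l := l) (hcvg f If)).
  + move=> z; have cz : z'.1 - z'.2 @[z' --> z] --> z.1 - z.2.
      by apply: cvgB; [exact: cvg_fst|exact: cvg_snd].
    exact: (cvgM cz cz).
  + by move=> z; exact: sqr_ge0.
  + move=> n; have [mX mY _ _] := moments n.
    by apply: measurable_funX; exact: measurable_funB.
  + by apply: measurable_funX; exact: measurable_funB.
  + by move=> n; have [_ _ _ ->] := moments n.
  + apply: cvgeB.
    * by rewrite fin_num_adde_defl// fin_numN.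
    * exact: hvarT.
    * exact: hvarS.
Qed.
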